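(* Let $(V,g)$ be an $n$-dimensional Euclidean real vector space, let $\omega$ be a symmetric $(p,p)$ double form on $V$ ($p\ge1$) satisfying the first Bianchi identity, and let $q$ be a positive integer such that $n\ge 2pq$. Then $$\frac{\mathrm c^{2pq}(\omega^{2q})}{(2pq)!}=\langle h_{(pq,pq)}(\omega),\omega^q\rangle=\sum_{r=0}^{pq}\frac{(-1)^{r+pq}}{(r!)^2}\langle \mathrm c^r\omega^q,\mathrm c^r\omega^q\rangle,$$ where $h_{(pq,pq)}(\omega)=*\frac{g^{n-2pq}\omega^q}{(n-2pq)!}$.
   Context: Let $(V,g)$ be a Euclidean real vector space of dimension $n$. A $(p,q)$ double form is an element of $\mathcal D^{p,q}=\Lambda^pV^*\otimes\Lambda^qV^*$, identified with a bilinear form $\Lambda^pV\times\Lambda^qV\to\mathbb R$. Exterior product: $(\theta_1\otimes\theta_2)(\theta_3\otimes\theta_4)=(\theta_1\wedge\theta_3)\otimes(\theta_2\wedge\theta_4)$, extended bilinearly; all products and powers in the claim are exterior products, with zeroth power $1$; $g$ is regarded as a $(1,1)$ double form. Inner product: $\langle\theta_1\otimes\theta_2,\theta_3\otimes\theta_4\rangle=\langle\theta_1,\theta_3\rangle\langle\theta_2,\theta_4\rangle$, using the inner product on $\Lambda^pV^*$ for which $e^{i_1}\wedge\dots\wedge e^{i_p}$, $i_1<\dots<i_p$, are orthonormal when $(e^i)$ is dual to an orthonormal basis. Contraction $\mathrm c:\mathcal D^{p,q}\to\mathcal D^{p-1,q-1}$: $\mathrm c\,\omega(x_1\wedge\dots\wedge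 x_{p-1},y_1\wedge\dots\wedge y_{q-1})=\sum_{j=1}^n\omega(e_j\wedge x_1\wedge\dots\wedge x_{p-1},e_j\wedge y_1\wedge\dots\wedge y_{q-1})$ for any orthonormal basis $(e_j)$; $\mathrm c^j$ is the $j$-fold iterate ($\mathrm c^0$ the identity). Double Hodge star: for a $(p,p)$ double form $\omega$, $*\omega$ is the $(n-p,n-p)$ double form $*\omega(u,v)=\omega( *u,*v)$, with $*$ on the right the usual Hodge star $\Lambda^{n-p}V\to\Lambda^{p}V$ for some chosen orientation (the result does not depend on it). A $(0,0)$ double form is a scalar. A $(p,p)$ double form $\omega$ is symmetric if $\omega(u,v)=\omega(v,u)$ for $u,v\in\Lambda^pV$, and satisfies the first Bianchi identity if $\sum_{j=1}^{p+1}(-1)^j\omega(x_1\wedge\dots\widehat{x_j}\dots\wedge x_{p+1},\;x_j\wedge y_1\wedge\dots\wedge y_{p-1})=0$ for all vectors $x_1,\dots,x_{p+1},y_1,\dots,y_{p-1}\in V$. (For $p=1$ this condition is equivalent to symmetry of the bilinear form.) *)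

(* Defs.v *)
From mathcomp Require Import all_boot all_order all_algebra.
From mathcomp Require Import sesquilinear reals.

Set Implicit Arguments.
Unset Strict Implicit.
Unset Printing Implicit Defensive.

Import Order.TTheory GRing.Theory Num.Theory.

Local Open Scope ring_scope.

(** An element of the exterior algebra of V^* is encoded by its values
    [theta [:: x1; ...; xp] = theta (x1 /\ ... /\ xp)] on lists of vectors of
    every length; a p-form is then a multilinear alternating function of p
    vectors, extended by 0 to lists of length other than p.  In the same way a
    double form is a function of two lists.  The degrees being carried by the
    predicates [alternating_form] and [double_form], products, powers and
    contractions need no casts between equal degrees.

    Normalisation: (e^1 /\ ... /\ e^p)(e_1, ..., e_p) = 1. *)

Section DoubleForms.
Variables (R : realType) (V : vectType R).

Definition form := seq V -> R.
Definition dform := seq V -> seq V -> R.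

Definition alternating_form (p : nat) (theta : form) : Prop :=
  [/\ forall s, size s != p -> theta s = 0,
      forall s1 s2 a u v,
        theta (s1 ++ (a *: u + v) :: s2)
        = a * theta (s1 ++ u :: s2) + theta (s1 ++ v :: s2)
    & forall s, ~~ uniq s -> theta s = 0].

Definition double_form (p q : nat) (omega : dform) : Prop :=
  (forall t, alternating_form p (omega^~ t)) /\
  (forall s, alternating_form q (omega s)).

Definition tensor (theta1 theta2 : form) : dform :=
  fun s t => theta1 s * theta2 t.

(** A bit mask on a list of arguments encodes a shuffle: the arguments marked
    [true] go to the first factor, the others to the second one.  The parity
    of the shuffle is the number of pairs (false, true) in this order. *)
Fixpoint inversions (m : bitseq) : nat :=
  if m is b :: m' then (~~ b * count id m' + inversions m')%N else 0%N.

Definition wedge (theta1 theta2 : form) : form := fun s =>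
  \sum_(m : (size s).-tuple bool)
     (-1) ^+ inversions m * theta1 (mask m s) * theta2 (mask (map negb m) s).

(** The product of double forms is the bilinear extension of the rule proved
    in [dmul_tensor] below. *)
Definition dmul (alpha beta : dform) : dform := fun s t =>
  \sum_(m : (size s).-tuple bool) \sum_(k : (size t).-tuple bool)
     (-1) ^+ inversions m * (-1) ^+ inversions k
     * alpha (mask m s) (mask k t)
     * beta (mask (map negb m) s) (mask (map negb k) t).

Lemma dmul_tensor (theta1 theta2 theta3 theta4 : form) s t :
  dmul (tensor theta1 theta2) (tensor theta3 theta4) s t
  = tensor (wedge theta1 theta3) (wedge theta2 theta4) s t.
Proof.
rewrite /dmul /tensor /wedge mulr_suml; apply: eq_bigr => m _.
rewrite mulr_sumr; apply: eq_bigr => k _.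
by rewrite -!mulrA; congr (_ * _); rewrite mulrCA; congr (_ * _);
   rewrite [in RHS]mulrCA; congr (_ * _); rewrite mulrCA.
Qed.

Definition dscale (a : R) (omega : dform) : dform := fun s t => a * omega s t.

Definition dunit : dform := fun s t => (nilp s && nilp t)%:R.

Definition dpow (omega : dform) (k : nat) : dform := iter k (dmul omega) dunit.

Definition dscalar (omega : dform) : R := omega [::] [::].

Definition symmetric_dform (omega : dform) : Prop :=
  forall s t, omega s t = omega t s.

(** The index j starts at 0, hence the exponent j + 1. *)
Definition first_bianchi (p : nat) (omega : dform) : Prop :=
  forall (x : p.+1.-tuple V) (y : p.-1.-tuple V),
    \sum_(j < p.+1)
       (-1) ^+ j.+1 * omega (take j x ++ drop j.+1 x) (tnth x j :: y) = 0.

Definition metric_form (g : {dot V for idfun}) : dform := fun s t =>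
  match s, t with
  | [:: u], [:: v] => g u v
  | _, _ => 0
  end.

Definition orthonormal_basis (g : {dot V for idfun}) (e : seq V) : Prop :=
  orthonormal g e /\ basis_of fullv e.

Section InOrthonormalBasis.
Variables (n : nat) (e : n.-tuple V).

(** A multi-index i_1 < ... < i_p is encoded by the bit mask I of the set
    {i_1, ..., i_p}, so that [mask I e] is the list e_{i_1}, ..., e_{i_p} and
    theta (mask I e) is the coordinate of theta on e^{i_1} /\ ... /\ e^{i_p}.
    The sums below run over all degrees; on forms of a given degree only the
    masks of the right cardinality contribute. *)

Definition form_inner (theta1 theta2 : form) : R :=
  \sum_(I : n.-tuple bool) theta1 (mask I e) * theta2 (mask I e).

Definition dinner (alpha beta : dform) : R :=
  \sum_(I : n.-tuple bool) \sum_(J : n.-tuple bool)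
     alpha (mask I e) (mask J e) * beta (mask I e) (mask J e).

Lemma dinner_tensor (theta1 theta2 theta3 theta4 : form) :
  dinner (tensor theta1 theta2) (tensor theta3 theta4)
  = form_inner theta1 theta3 * form_inner theta2 theta4.
Proof.
rewrite /dinner /form_inner mulr_suml; apply: eq_bigr => I _.
by rewrite mulr_sumr; apply: eq_bigr => J _; rewrite /tensor mulrACA.
Qed.

Definition contraction (omega : dform) : dform := fun s t =>
  \sum_(j < n) omega (tnth e j :: s) (tnth e j :: t).

(** The volume form of V for the orientation in which e is direct. *)
Definition vol (g : {dot V for idfun}) (s : seq V) : R :=
  \det (\matrix_(i < n, j < n) g s`_i (tnth e j)).

(** [hodge g theta] is the composite of theta with the Hodge star of the
    exterior algebra of V,
      * (x_1 /\ ... /\ x_k) = \sum_(|I| = n - k) vol(x_1, ..., x_k, e_I) e_I,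
    which is the expansion in the e_I of the usual u /\ * v = <u, v> vol. *)
Definition hodge (g : {dot V for idfun}) (theta : form) : form := fun s =>
  \sum_(I : n.-tuple bool | count id I + size s == n)
     vol g (s ++ mask I e) * theta (mask I e).

Definition double_hodge (g : {dot V for idfun}) (omega : dform) : dform :=
  fun s t => hodge g (fun s' => hodge g (omega s') t) s.

Definition h_form (g : {dot V for idfun}) (p q : nat) (omega : dform) : dform :=
  double_hodge g
    (dscale ((n - 2 * p * q)`!%:R)^-1
       (dmul (dpow (metric_form g) (n - 2 * p * q)) (dpow omega q))).

End InOrthonormalBasis.

End DoubleForms.

(* Main.v *)
Require Import Defs.
From mathcomp Require Import all_boot all_order all_algebra.
From mathcomp Require Import sesquilinear reals.
From mathcomp Require Import boolp functions perm zify ring.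

Set Implicit Arguments.
Unset Strict Implicit.
Unset Printing Implicit Defensive.

Import Order.TTheory GRing.Theory Num.Theory.

Local Open Scope ring_scope.

(** Write [k = pq] and [eta = omega^q].  Expanding the Hodge star in the basis,
    <* X, eta> is the value of [eta X] on (e_1 /\ ... /\ e_n, e_1 /\ ... /\ e_n).
    For [X = g^(n-2k) eta / (n-2k)!] the commutation relation
    c (g a) = g (c a) + (n - 2 deg a) a turns this value into
    c^(2k) (eta^2) / (2k)!.

    For the second equality, write the contraction of a product [alpha beta] as
    A + B + C + D, where each inserted pair (e_j, e_j) goes to [alpha], is
    distributed over the two factors in one of two ways, or goes to [beta].
    These operators commute on alternating forms.  In (A + B + C + D)^(2k)
    applied to (eta, eta) only the terms A^r B^(k-r) C^(k-r) D^r have the right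
    degrees, and such a term is, up to a factor, the inner product of c^r eta
    with its transpose. *)

(** * Sums over bit masks, and the parity of a complementary mask *)

Section BitSums.
Variable M : nmodType.

Lemma big_tuple0_bool (F : bitseq -> M) :
  \sum_(m : 0.-tuple bool) F m = F [::].
Proof.
rewrite (bigD1 [tuple]) //= big1 ?addr0 // => m /eqP[].
exact: tuple0.
Qed.

Lemma big_tupleS_bool n (F : bitseq -> M) :
  \sum_(m : n.+1.-tuple bool) F m
  = \sum_(m : n.-tuple bool) F (true :: m) + \sum_(m : n.-tuple bool) F (false :: m).
Proof.
pose h (x : bool * n.-tuple bool) : n.+1.-tuple bool := [tuple of x.1 :: x.2].
pose h' (m : n.+1.-tuple bool) := (thead m, [tuple of behead m]).
rewrite (reindex h); last first.
  exists h' => [[b m] _|m _]; last by rewrite /h /h' [RHS]tuple_eta; apply: val_inj.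
  by congr (_, _); apply: val_inj.
rewrite -(pair_bigA _ (fun b (m : n.-tuple bool) => F (b :: m))) /=.
by rewrite big_bool.
Qed.

Lemma big_tuple_cast_bool n k (F : bitseq -> M) : n = k ->
  \sum_(m : n.-tuple bool) F m = \sum_(m : k.-tuple bool) F m.
Proof. by move=> ->. Qed.

Lemma big_tuple_negb n (F : bitseq -> M) :
  \sum_(m : n.-tuple bool) F m = \sum_(m : n.-tuple bool) F (map negb m).
Proof.
pose h (m : n.-tuple bool) : n.-tuple bool := [tuple of map negb m].
rewrite (reindex h) //; exists h => m _; apply: val_inj; rewrite /= -map_comp;
  by rewrite (eq_map (g := id)) ?map_id // => b /=; rewrite negbK.
Qed.

End BitSums.

Lemma count_negb (m : bitseq) : count id (map negb m) = (size m - count id m)%N.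
Proof. by rewrite -(count_predC id m) addKn count_map. Qed.

(** Each pair made of a marked and an unmarked position is an inversion of exactly one of the mask
    and its complement. *)
Lemma inversions_negb (m : bitseq) :
  (inversions (map negb m) + inversions m = count id m * count id (map negb m))%N.
Proof. by elim: m => //= -[] m IH /=; rewrite ?negbK /=; lia. Qed.

Lemma size_mask_split (T : Type) n (m : n.-tuple bool) (s : seq T) : size s = n ->
  (size (mask m s) + size (mask (map negb m) s) = n)%N.
Proof.
move=> sz; rewrite !size_mask ?size_map ?size_tuple // count_map.
by rewrite count_predC size_tuple.
Qed.

(** * The algebra of double forms: linearity, interior products, associativity, commutativity *)

Section Products.
Variables (R : realType) (V : vectType R).
Local Notation dform := (dform V).

(** A function of four lists generalizes [alpha s t * beta s' t'], the pair
    of factors of a product. *)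
Definition qform := seq V -> seq V -> seq V -> seq V -> R.

Definition qmul (alpha beta : dform) : qform :=
  fun s t s' t' => alpha s t * beta s' t'.

Definition shuffle_term (Phi : qform) (s t : seq V) (m k : bitseq) : R :=
  (-1) ^+ inversions m * (-1) ^+ inversions k
  * Phi (mask m s) (mask k t) (mask (map negb m) s) (mask (map negb k) t).

Definition shuffle (Phi : qform) : dform := fun s t =>
  \sum_(m : (size s).-tuple bool) \sum_(k : (size t).-tuple bool)
     shuffle_term Phi s t m k.

Lemma dmul_shuffle (alpha beta : dform) :
  dmul alpha beta = shuffle (qmul alpha beta).
Proof.
apply/funext => s; apply/funext => t; rewrite /dmul /shuffle.
by apply: eq_bigr => m _; apply: eq_bigr => k _; rewrite /shuffle_term /qmul mulrA.
Qed.

Lemma shuffle_nil (Phi : qform) : shuffle Phi [::] [::] = Phi [::] [::] [::] [::].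
Proof.
pose F m := \sum_(k : 0.-tuple bool) shuffle_term Phi [::] [::] m k.
rewrite /shuffle (big_tuple0_bool F) /F.
by rewrite (big_tuple0_bool (shuffle_term Phi _ _ _)) /shuffle_term /= !mul1r.
Qed.

(** Splits the sum over [m] by its first bit. A head sent to the second factor precedes all the left
    arguments of the first one, hence a sign for each of them. *)
Lemma shuffle_consl (Phi : qform) v s t :
  shuffle Phi (v :: s) t
  = shuffle (fun s t s' t' =>
               Phi (v :: s) t s' t' + (-1) ^+ size s * Phi s t (v :: s') t') s t.
Proof.
pose F m := \sum_(k : (size t).-tuple bool) shuffle_term Phi (v :: s) t m k.
rewrite /shuffle (big_tupleS_bool _ F) /F.
rewrite -big_split /=; apply: eq_bigr => m _.
rewrite -big_split /=; apply: eq_bigr => k _.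
rewrite /shuffle_term /= mul0n add0n mul1n exprD size_mask ?size_tuple //; ring.
Qed.

Lemma shuffle_consr (Phi : qform) v s t :
  shuffle Phi s (v :: t)
  = shuffle (fun s t s' t' =>
               Phi s (v :: t) s' t' + (-1) ^+ size t * Phi s t s' (v :: t')) s t.
Proof.
rewrite /shuffle; apply: eq_bigr => m _.
rewrite (big_tupleS_bool _ (shuffle_term Phi s (v :: t) m)).
rewrite -big_split /=; apply: eq_bigr => k _.
rewrite /shuffle_term /= mul0n add0n mul1n exprD (@size_mask _ k t) ?size_tuple //; ring.
Qed.

Lemma shuffle_sum (I : finType) (Phi : I -> qform) s t :
  shuffle (fun a b c d => \sum_i Phi i a b c d) s t = \sum_i shuffle (Phi i) s t.
Proof.
rewrite /shuffle [RHS]exchange_big; apply: eq_bigr => m _.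
rewrite [RHS]exchange_big; apply: eq_bigr => k _.
by rewrite /shuffle_term mulr_sumr.
Qed.

Lemma shuffle_lin (a : R) (Phi Psi : qform) s t :
  shuffle (fun s t s' t' => a * Phi s t s' t' + Psi s t s' t') s t
  = a * shuffle Phi s t + shuffle Psi s t.
Proof.
rewrite /shuffle mulr_sumr -big_split; apply: eq_bigr => m _ /=.
rewrite mulr_sumr -big_split; apply: eq_bigr => k _; rewrite /shuffle_term /=; ring.
Qed.

Lemma shuffleD (Phi Psi : qform) s t :
  shuffle (fun s t s' t' => Phi s t s' t' + Psi s t s' t') s t
  = shuffle Phi s t + shuffle Psi s t.
Proof.
rewrite -[X in X + _]mul1r -shuffle_lin; congr (shuffle _ s t).
by do 4![apply/funext => ?]; rewrite mul1r.
Qed.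

Lemma dmul_linl (a : R) (alpha alpha' beta : dform) s t :
  dmul (fun s t => a * alpha s t + alpha' s t) beta s t
  = a * dmul alpha beta s t + dmul alpha' beta s t.
Proof.
rewrite !dmul_shuffle -shuffle_lin; congr (shuffle _ s t).
by do 4![apply/funext => ?]; rewrite /qmul; ring.
Qed.

Lemma dmul_linr (a : R) (alpha beta beta' : dform) s t :
  dmul alpha (fun s t => a * beta s t + beta' s t) s t
  = a * dmul alpha beta s t + dmul alpha beta' s t.
Proof.
rewrite !dmul_shuffle -shuffle_lin; congr (shuffle _ s t).
by do 4![apply/funext => ?]; rewrite /qmul; ring.
Qed.

Lemma dmulDl (alpha alpha' beta : dform) s t :
  dmul (fun s t => alpha s t + alpha' s t) beta s t
  = dmul alpha beta s t + dmul alpha' beta s t.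
Proof.
rewrite !dmul_shuffle -shuffleD; congr (shuffle _ s t).
by do 4![apply/funext => ?]; rewrite /qmul; ring.
Qed.

Lemma dmulDr (alpha beta beta' : dform) s t :
  dmul alpha (fun s t => beta s t + beta' s t) s t
  = dmul alpha beta s t + dmul alpha beta' s t.
Proof.
rewrite !dmul_shuffle -shuffleD; congr (shuffle _ s t).
by do 4![apply/funext => ?]; rewrite /qmul; ring.
Qed.

Lemma dmulZl (a : R) (alpha beta : dform) s t :
  dmul (fun s t => a * alpha s t) beta s t = a * dmul alpha beta s t.
Proof.
rewrite /dmul mulr_sumr; apply: eq_bigr => m _; rewrite mulr_sumr.
by apply: eq_bigr => k _; ring.
Qed.

Lemma dmulZr (a : R) (alpha beta : dform) s t :
  dmul alpha (fun s t => a * beta s t) s t = a * dmul alpha beta s t.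
Proof.
rewrite /dmul mulr_sumr; apply: eq_bigr => m _; rewrite mulr_sumr.
by apply: eq_bigr => k _; ring.
Qed.

Definition transp (alpha : dform) : dform := fun s t => alpha t s.

Lemma dmul_transp (alpha beta : dform) s t :
  dmul (transp alpha) (transp beta) s t = dmul alpha beta t s.
Proof.
rewrite /dmul exchange_big; apply: eq_bigr => k _; apply: eq_bigr => m _.
by rewrite /transp [_ ^+ _ * _ ^+ _]mulrC.
Qed.

Definition iprodl (v : V) (alpha : dform) : dform := fun s t => alpha (v :: s) t.
Definition iprodr (v : V) (alpha : dform) : dform := fun s t => alpha s (v :: t).
(** The grading involution in the left degree; it is the sign that makes [iprodl] an antiderivation
    of the product. *)
Definition signl (alpha : dform) : dform := fun s t => (-1) ^+ size s * alpha s t.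
Definition signr (alpha : dform) : dform := fun s t => (-1) ^+ size t * alpha s t.

Lemma iprodl_dmul v (alpha beta : dform) :
  iprodl v (dmul alpha beta)
  = fun s t => dmul (iprodl v alpha) beta s t + dmul (signl alpha) (iprodl v beta) s t.
Proof.
apply/funext => s; apply/funext => t.
rewrite /iprodl !dmul_shuffle shuffle_consl -shuffleD; congr (shuffle _ s t).
by do 4![apply/funext => ?]; rewrite /qmul /signl; ring.
Qed.

Lemma iprodr_dmul v (alpha beta : dform) :
  iprodr v (dmul alpha beta)
  = fun s t => dmul (iprodr v alpha) beta s t + dmul (signr alpha) (iprodr v beta) s t.
Proof.
apply/funext => s; apply/funext => t.
rewrite /iprodr !dmul_shuffle shuffle_consr -shuffleD; congr (shuffle _ s t).
by do 4![apply/funext => ?]; rewrite /qmul /signr; ring.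
Qed.

Lemma signl_dmul (alpha beta : dform) :
  signl (dmul alpha beta) = dmul (signl alpha) (signl beta).
Proof.
apply/funext => s; apply/funext => t.
rewrite /signl /dmul mulr_sumr; apply: eq_bigr => m _; rewrite mulr_sumr.
apply: eq_bigr => k _.
rewrite -[X in (-1) ^+ X * (_ * _ * _ * _)](size_mask_split m (erefl (size s))).
by rewrite exprD; ring.
Qed.

Lemma signr_dmul (alpha beta : dform) :
  signr (dmul alpha beta) = dmul (signr alpha) (signr beta).
Proof.
apply/funext => s; apply/funext => t.
rewrite /signr /dmul mulr_sumr; apply: eq_bigr => m _; rewrite mulr_sumr.
apply: eq_bigr => k _.
rewrite -[X in (-1) ^+ X * (_ * _ * _ * _)](size_mask_split k (erefl (size t))).
by rewrite exprD; ring.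
Qed.

Lemma dmul_nil (alpha beta : dform) :
  dmul alpha beta [::] [::] = alpha [::] [::] * beta [::] [::].
Proof. by rewrite dmul_shuffle shuffle_nil. Qed.

Lemma dmul_consl (alpha beta : dform) v s t :
  dmul alpha beta (v :: s) t
  = dmul (iprodl v alpha) beta s t + dmul (signl alpha) (iprodl v beta) s t.
Proof. by rewrite -[LHS]/(iprodl v (dmul alpha beta) s t) iprodl_dmul. Qed.

Lemma dmul_consr (alpha beta : dform) v s t :
  dmul alpha beta s (v :: t)
  = dmul (iprodr v alpha) beta s t + dmul (signr alpha) (iprodr v beta) s t.
Proof. by rewrite -[LHS]/(iprodr v (dmul alpha beta) s t) iprodr_dmul. Qed.

(** Induction on the argument lists avoids triple shuffles: the antiderivation rules strip one
    vector at a time from both sides, leaving shorter instances with other factors, so the induction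
    is over all triples of factors. *)
Lemma dmulA : associative (@dmul R V).
Proof.
move=> alpha beta gamma; apply/funext => s; apply/funext => t.
elim: s => [|v s IH] in alpha beta gamma *.
  elim: t => [|v t IH] in alpha beta gamma *; first by rewrite !dmul_nil mulrA.
  by rewrite !dmul_consr !iprodr_dmul dmulDl dmulDr !IH signr_dmul addrA.
by rewrite !dmul_consl !iprodl_dmul dmulDl dmulDr !IH signl_dmul addrA.
Qed.

(** Only the degree condition of [double_form], kept apart from multilinearity and alternation
    because many facts rest on degrees alone. *)
Definition dhom (p q : nat) (alpha : dform) : Prop :=
  forall s t, ~~ ((size s == p) && (size t == q)) -> alpha s t = 0.

Lemma dhom_dmul p q p' q' (alpha beta : dform) :
  dhom p q alpha -> dhom p' q' beta -> dhom (p + p') (q + q') (dmul alpha beta).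
Proof.
move=> ha hb s t hst; rewrite /dmul big1 // => m _; rewrite big1 // => k _.
have := size_mask_split m (erefl (size s)).
have := size_mask_split k (erefl (size t)).
set s1 := mask m s; set t1 := mask k t; move=> E1 E2.
have [/andP[/eqP h1 /eqP h2]|/ha->] := boolP ((size s1 == p) && (size t1 == q));
  last by rewrite mulr0 mul0r.
rewrite [beta _ _]hb ?mulr0 //; apply: contra hst.
by move: E1 E2; rewrite h1 h2; lia.
Qed.

(** Complementing both masks exchanges the factors. By [inversions_negb] each of the two shuffle
    signs changes by [(-1) ^+ (p * q)], and the two changes cancel. *)
Lemma dmulC p q (alpha beta : dform) :
  dhom p p alpha -> dhom q q beta -> dmul alpha beta = dmul beta alpha.
Proof.
move=> ha hb; apply/funext => s; apply/funext => t.
rewrite !dmul_shuffle /shuffle.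
under [RHS]eq_bigr => m _ do
  rewrite (big_tuple_negb _ (shuffle_term (qmul beta alpha) s t m)).
pose F m := \sum_(k : (size t).-tuple bool)
  shuffle_term (qmul beta alpha) s t m (map negb k).
rewrite [RHS](big_tuple_negb _ F) /F.
have nK (T : Type) (m : bitseq) (u : seq T): mask (map negb (map negb m)) u = mask m u.
  by rewrite -map_comp (eq_map (g := id)) ?map_id // => b /=; rewrite negbK.
apply: eq_bigr => m _; apply: eq_bigr => k _; rewrite /shuffle_term /qmul !nK.
have [/andP[/eqP h1 /eqP h2]|/ha->] :=
  boolP ((size (mask m s) == p) && (size (mask k t) == p));
  last by rewrite !(mulr0, mul0r).
have [/andP[/eqP h3 /eqP h4]|/hb->] :=
  boolP ((size (mask (map negb m) s) == q) && (size (mask (map negb k) t) == q));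
  last by rewrite !(mulr0, mul0r).
rewrite size_mask ?size_tuple // in h1; rewrite size_mask ?size_tuple // in h2.
rewrite size_mask ?size_map ?size_tuple // in h3.
rewrite size_mask ?size_map ?size_tuple // in h4.
have sgn (l : bitseq) : (-1) ^+ inversions (map negb l)
    = (-1) ^+ inversions l * (-1) ^+ (count id l * count id (map negb l)) :> R.
  by rewrite -inversions_negb addnC exprD signrMK.
rewrite !sgn h1 h2 h3 h4.
rewrite -[LHS]mulr1 -[X in _ * X = _](sqrr_sign R (p * q)); ring.
Qed.

Lemma dmul1l (alpha : dform) : dmul (@dunit R V) alpha = alpha.
Proof.
have h0 (s t : seq V) (beta : dform) : dmul (fun _ _ => 0) beta s t = 0.
  by rewrite /dmul big1 // => m _; rewrite big1 // => k _; rewrite mulr0 mul0r.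
apply/funext => s; apply/funext => t.
elim: s => [|v s IH] in alpha *; last first.
  rewrite dmul_consl.
  have -> : iprodl v (@dunit R V) = fun _ _ => 0 by [].
  have -> : signl (@dunit R V) = @dunit R V.
    by apply/funext=> -[|? ?]; apply/funext => ?; rewrite /signl /dunit ?mul1r // mulr0.
  by rewrite h0 add0r IH.
elim: t => [|v t IH] in alpha *; first by rewrite dmul_nil mul1r.
rewrite dmul_consr.
have -> : iprodr v (@dunit R V) = fun _ _ => 0.
  by apply/funext=> ?; apply/funext=> ?; rewrite /iprodr /dunit andbF.
have -> : signr (@dunit R V) = @dunit R V.
  apply/funext=> ?; apply/funext=> -[|? ?]; rewrite /signr /dunit ?mul1r //=.
  by rewrite andbF mulr0.
by rewrite h0 add0r IH.
Qed.

Lemma dpowD (alpha : dform) a b :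
  dpow alpha (a + b) = dmul (dpow alpha a) (dpow alpha b).
Proof.
elim: a => [|a IH]; first by rewrite dmul1l.
by rewrite addSn /= -/(dpow _ _) IH dmulA.
Qed.

Lemma dhom_dunit : dhom 0 0 (@dunit R V).
Proof. by move=> [|u s] [|v t]. Qed.

Lemma dhom_dpow p q (alpha : dform) k :
  dhom p q alpha -> dhom (p * k) (q * k) (dpow alpha k).
Proof.
move=> h; elim: k => [|k IH]; first by rewrite !muln0; apply: dhom_dunit.
by rewrite !mulnS; apply: dhom_dmul.
Qed.

Lemma dpow_sym (alpha : dform) k :
  symmetric_dform alpha -> symmetric_dform (dpow alpha k).
Proof.
move=> h; have E b : symmetric_dform b -> transp b = b.
  by move=> hb; apply/funext => s; apply/funext => t; rewrite /transp hb.
elim: k => [|k IH] s t; first by rewrite /= /dunit andbC.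
by rewrite /= -dmul_transp !E.
Qed.

End Products.

(** * Repeated insertion of the vectors of a list into a symmetric function *)

Section IteratedSums.
Variables (R : zmodType) (T : Type).

(** Models a contraction along the diagonal, where two argument lists receive the same vectors and
    stay equal. *)
Definition cons_sum (e : seq T) (F : seq T -> R) : seq T -> R :=
  fun w => \sum_(y <- e) F (y :: w).

(** The behaviour of a product of two alternating functions evaluated at the same list: the two
    signs of a swap cancel, and a repetition gives 0. *)
Definition swap_invariant (F : seq T -> R) : Prop :=
  (forall s1 s2 u v, F (s1 ++ u :: v :: s2) = F (s1 ++ v :: u :: s2)) /\
  (forall s1 s2 u, F (s1 ++ u :: u :: s2) = 0).

Lemma swap_invariant_cons F x :
  swap_invariant F -> swap_invariant (fun w => F (x :: w)).
Proof. by case=> h1 h2; split=> [s1 s2 u v|s1 s2 u]; rewrite -!cat_cons. Qed.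

Lemma swap_invariant_cons_sum e F : swap_invariant F -> swap_invariant (cons_sum e F).
Proof.
move=> hF; split=> [s1 s2 u v|s1 s2 u].
  by apply: eq_bigr => y _; rewrite -!cat_cons (proj1 hF).
by apply: big1 => y _; rewrite -!cat_cons (proj2 hF).
Qed.

Lemma iter_cons_sumD e b F G :
  iter b (cons_sum e) (fun w => F w + G w)
  = fun w => iter b (cons_sum e) F w + iter b (cons_sum e) G w.
Proof.
elim: b => //= b ->; apply/funext => w.
by rewrite /cons_sum -big_split.
Qed.

(** Among the [b] insertions [x] can be chosen at most once, since a repetition gives 0; if chosen,
    it may occur at any of the [b] stages, all with the same value by symmetry. *)
Lemma iter_cons_sum_cons x e b F : swap_invariant F ->
  iter b (cons_sum (x :: e)) F
  = fun w => iter b (cons_sum e) F w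
             + iter b.-1 (cons_sum e) (fun w => F (x :: w)) w *+ b.
Proof.
elim: b F => [|b IH] F hF; first by apply/funext=> w; rewrite /= mulr0n addr0.
rewrite iterSr IH; last exact: swap_invariant_cons_sum.
have E : cons_sum (x :: e) F = fun w => cons_sum e F w + F (x :: w).
  by apply/funext => w; rewrite /cons_sum big_cons addrC.
have -> : (fun w => cons_sum (x :: e) F (x :: w)) = cons_sum e (fun w => F (x :: w)).
  apply/funext => w; rewrite /cons_sum big_cons (proj2 hF [::]) add0r.
  by apply: eq_bigr => y _; rewrite (proj1 hF [::]).
apply/funext => w; rewrite E iter_cons_sumD -iterSr mulrS -[LHS]addrA.
congr (_ + (_ + _)); case: b {IH} => [|b]; first by rewrite !mulr0n.
by rewrite -iterSr.
Qed.

(* Each set of b distinct elements is listed in b! orders. *)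
Lemma iter_cons_sum_mask e b F : swap_invariant F ->
  (forall s, size s != b -> F s = 0) ->
  iter b (cons_sum e) F [::]
  = (\sum_(I : (size e).-tuple bool) F (mask I e)) *+ b`!.
Proof.
elim: e b F => [|x e IH] b F hF hb.
  rewrite (big_tuple0_bool (fun I => F (mask I [::]))) /=.
  case: b hb => [|b] hb //=.
  by rewrite hb // mul0rn /cons_sum big_nil.
rewrite iter_cons_sum_cons // (big_tupleS_bool _ (fun I => F (mask I (x :: e)))).
rewrite addrC mulrnDl; congr (_ + _); last exact: IH.
case: b hb => [|b] hb.
  (* For [b = 0] a mask selecting [x] produces a nonempty list, where [F] vanishes. *)
  by rewrite /= big1 => [|i _]; rewrite ?mul0rn ?mulr0n ?hb.
rewrite [b.+1.-1]/= (IH _ (fun w => F (x :: w))).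
- by rewrite -mulrnA mulnC -factS.
- exact: swap_invariant_cons.
- by move=> s hs; apply: hb.
Qed.

End IteratedSums.

(** * Multilinear alternating double forms and their closure properties *)

Section Alternating.
Variables (R : realType) (V : vectType R).
Local Notation dform := (dform V).

Definition antisym (theta : seq V -> R) : Prop :=
  forall s1 s2 u v, theta (s1 ++ u :: v :: s2) = - theta (s1 ++ v :: u :: s2).

Definition multilin (theta : seq V -> R) : Prop :=
  forall s1 s2 a u v,
    theta (s1 ++ (a *: u + v) :: s2)
    = a * theta (s1 ++ u :: s2) + theta (s1 ++ v :: s2).

Definition malt theta := multilin theta /\ antisym theta.

(** Polarization: the value at two adjacent copies of [u + v] is 0 and expands into the sum of the
    two swapped values. *)
Lemma malt_alternating_form p (theta : seq V -> R) : alternating_form p theta -> malt theta.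
Proof.
case=> _ hl ha; split=> // s1 s2 u v.
have h0 x : theta (s1 ++ x :: x :: s2) = 0.
  by apply: ha; rewrite cat_uniq /= in_cons eqxx /= !andbF.
have hD x y z : theta (s1 ++ z :: (x + y) :: s2)
    = theta (s1 ++ z :: x :: s2) + theta (s1 ++ z :: y :: s2).
  by rewrite -!(cat_rcons z) -{1}[x]scale1r hl mul1r.
have := h0 (u + v).
rewrite -{1}[u]scale1r hl mul1r !hD !h0 add0r addr0.
by move=> /eqP; rewrite addr_eq0 => /eqP.
Qed.

Definition lalt (alpha : dform) := forall t, malt (alpha^~ t).
(** The right list is reached through [transp], so that closure under products has to be proved for
    the left list only. *)
Definition dalt (alpha : dform) := lalt alpha /\ lalt (transp alpha).

Lemma dalt_double_form p q (alpha : dform) : double_form p q alpha -> dalt alpha.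
Proof.
by case=> h1 h2; split=> t;
  [apply: malt_alternating_form (h1 t)|apply: malt_alternating_form (h2 t)].
Qed.

Lemma dhom_double_form p q (alpha : dform) : double_form p q alpha -> dhom p q alpha.
Proof.
case=> h1 h2 s t; rewrite negb_and => /orP[] h.
  by have [] := h1 t => + _ _; apply.
by have [] := h2 s => + _ _; apply.
Qed.

Lemma malt_cons v theta : malt theta -> malt (fun s => theta (v :: s)).
Proof. by case=> h1 h2; split=> [s1 s2 a u w|s1 s2 u w]; rewrite -!cat_cons. Qed.

Lemma lalt_iprodl alpha (h : lalt alpha) v : lalt (iprodl v alpha).
Proof. by move=> t; apply: (malt_cons v (h t)). Qed.

Lemma lalt_signl alpha : lalt alpha -> lalt (signl alpha).
Proof.
move=> h t; have [h1 h2] := h t; split=> [s1 s2 a u w|s1 s2 u w]; rewrite /signl.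
  by rewrite h1 !size_cat /=; ring.
by rewrite h2 !size_cat /=; ring.
Qed.

Lemma signl_iprodl v (alpha : dform) :
  signl (iprodl v alpha) = fun s t => -1 * iprodl v (signl alpha) s t.
Proof.
by apply/funext=> s; apply/funext=> t; rewrite /signl /iprodl /= exprS; ring.
Qed.

(** Interior products remove the prefix [s1]. At the head of the list, multilinearity is the
    linearity of [iprodl] in its vector, and antisymmetry is the anticommutation of two interior
    products. *)
Lemma lalt_dmul alpha beta : lalt alpha -> lalt beta -> lalt (dmul alpha beta).
Proof.
move=> ha hb t; split=> s1.
  elim: s1 => [|w s1 IH] in alpha beta ha hb * => s2 a u v /=; last first.
    rewrite !dmul_consl (IH _ _ (lalt_iprodl ha w) hb).
    by rewrite (IH _ _ (lalt_signl ha) (lalt_iprodl hb w)); ring.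
  rewrite !dmul_consl.
  have E g : lalt g -> iprodl (a *: u + v) g = fun s t => a * iprodl u g s t + iprodl v g s t.
    move=> hg; apply/funext=> s; apply/funext=> t'.
    exact: (proj1 (hg t') [::] s).
  by rewrite !E // dmul_linl dmul_linr; ring.
elim: s1 => [|w s1 IH] in alpha beta ha hb * => s2 u v /=; last first.
  rewrite !dmul_consl (IH _ _ (lalt_iprodl ha w) hb).
  by rewrite (IH _ _ (lalt_signl ha) (lalt_iprodl hb w)); ring.
have E g : lalt g -> iprodl v (iprodl u g) = fun s t => -1 * iprodl u (iprodl v g) s t.
  move=> hg; apply/funext=> s; apply/funext=> t'; rewrite mulN1r.
  exact: (proj2 (hg t') [::] s).
rewrite !dmul_consl !signl_iprodl (E alpha) // (E beta) //.
by rewrite !dmulZl dmulZr; ring.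
Qed.

Lemma transp_dmul (alpha beta : dform) :
  transp (dmul alpha beta) = dmul (transp alpha) (transp beta).
Proof. by apply/funext=> s; apply/funext=> t; rewrite dmul_transp. Qed.

Lemma dalt_dmul alpha beta : dalt alpha -> dalt beta -> dalt (dmul alpha beta).
Proof.
by case=> a1 a2 [b1 b2]; split; rewrite ?transp_dmul; apply: lalt_dmul.
Qed.

Lemma dalt_dunit : dalt (@dunit R V).
Proof.
split=> t; split=> s1 s2 *; rewrite /transp /dunit ?(andbC (nilp t));
  by case: s1 => [|? ?]; rewrite /= ?mulr0 ?addr0 ?oppr0.
Qed.

Lemma dalt_dpow alpha k : dalt alpha -> dalt (dpow alpha k).
Proof.
by move=> h; elim: k => [|k IH]; [apply: dalt_dunit|apply: dalt_dmul].
Qed.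

Lemma dalt_swap_invariant alpha :
  dalt alpha -> swap_invariant (fun w => alpha w w).
Proof.
case=> hl hr; split=> [s1 s2 u v|s1 s2 u].
  rewrite (proj2 (hl _)) -[alpha _ _]/(transp alpha _ _) (proj2 (hr _)).
  by rewrite opprK.
(* Antisymmetry at equal entries makes the value its own opposite, hence 0. *)
have /eqP := proj2 (hl (s1 ++ u :: u :: s2)) s1 s2 u u.
by rewrite -addr_eq0 -mulr2n mulrn_eq0 /= => /eqP.
Qed.

End Alternating.

(** * Contraction: alternation, degrees, and the full contraction of a top form *)

Section Contraction.
Variables (R : realType) (V : vectType R) (n : nat) (e : n.-tuple V).
Local Notation dform := (dform V).
Local Notation c := (contraction e).

Lemma malt_sum (I : finType) (f : I -> seq V -> R) :
  (forall i, malt (f i)) -> malt (fun s => \sum_i f i s).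
Proof.
move=> h; split=> [s1 s2 a u v|s1 s2 u v].
  rewrite mulr_sumr -big_split; apply: eq_bigr => i _; exact: (proj1 (h i)).
rewrite -sumrN; apply: eq_bigr => i _; exact: (proj2 (h i)).
Qed.

Lemma dalt_contraction alpha : dalt alpha -> dalt (c alpha).
Proof.
by case=> hl hr; split=> t; apply: malt_sum => j;
  [apply: (malt_cons _ (hl _))|apply: (malt_cons _ (hr _))].
Qed.

Lemma dalt_iter_contraction r alpha : dalt alpha -> dalt (iter r c alpha).
Proof. by move=> h; elim: r => //= r; apply: dalt_contraction. Qed.

Lemma dhom_contraction p q alpha : dhom p q alpha -> dhom p.-1 q.-1 (c alpha).
Proof. by move=> h s t hst; apply: big1 => j _; apply: h => /=; lia. Qed.

Lemma dhom_iter_contraction p q r alpha :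
  dhom p q alpha -> dhom (p - r) (q - r) (iter r c alpha).
Proof.
move=> h; elim: r => [|r IH]; first by rewrite !subn0.
by rewrite !subnS; apply: dhom_contraction.
Qed.

Lemma iter_contraction_diag r alpha w :
  iter r c alpha w w = iter r (cons_sum e) (fun w => alpha w w) w.
Proof.
elim: r w => //= r IH w; rewrite /contraction /cons_sum big_tuple.
by apply: eq_bigr => j _; rewrite -IH.
Qed.

(** The [n] contractions list the basis in its [n]! orders, all with the same value; for reasons of
    degree only the full mask contributes. *)
Lemma iter_contraction_top alpha : dalt alpha -> dhom n n alpha ->
  iter n c alpha [::] [::] = n`!%:R * alpha e e.
Proof.
move=> ha hh; rewrite iter_contraction_diag iter_cons_sum_mask; first last.
- by move=> s /negbTE hs; apply: hh; rewrite hs.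
- exact: dalt_swap_invariant.
rewrite (big_tuple_cast_bool (fun I => alpha (mask I e) (mask I e)) (size_tuple e)).
rewrite (bigD1 [tuple of nseq n true]) //= big1 ?addr0 => [|I hI].
  by rewrite mask_true ?size_tuple // mulr_natl.
apply: hh; rewrite andbb size_mask ?size_tuple //; apply: contra hI => hI.
have /all_pred1P E : all (pred1 true) I.
  by rewrite (eq_all (a2 := id)) => [|[]] //; rewrite all_count size_tuple.
by apply/eqP/val_inj; rewrite [LHS]E size_tuple.
Qed.

End Contraction.

(** * Commutation of the contraction with the product by the metric *)

Section Metric.
Variables (R : realType) (V : vectType R) (g : {dot V for idfun}).
Variables (n : nat) (e : n.-tuple V) (e_onb : orthonormal_basis g e).
Local Notation dform := (dform V).
Local Notation c := (contraction e).
Local Notation G := (metric_form g).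

Lemma metricC u v : g u v = g v u.
Proof. by rewrite hermC expr0 mul1r. Qed.

Lemma uniq_onb : uniq e.
Proof. by case: e_onb => _ /basis_free /free_uniq. Qed.

Lemma metric_onb i j : g (tnth e i) (tnth e j) = (i == j)%:R.
Proof.
have [+ _] := e_onb; rewrite /orthonormal => /andP[/allP h1 h2].
have [->|ij] := eqVneq i j; first by apply/eqP/(h1 (tnth e j)); rewrite mem_tnth.
(* The recursive predicate compares an entry only with later ones; the other order follows by
   symmetry of [g]. *)
have h s (a b : nat) : pair_ortho_rec (theta := idfun) g s ->
    (a < b < size s)%N -> g s`_a s`_b = 0.
  elim: s a b => [|x s IH] a b; first by rewrite ltn0 andbF.
  rewrite /= => /andP[]; rewrite andbT => /allP hx hs.
  case: a b => [|a] [|b] //= /= hab; last exact: IH.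
  by apply/eqP/hx; rewrite mem_nth.
wlog lij : i j ij / (i < j)%N.
  move=> H; have [/H->//|//|E] := ltngtP i j.
    by move=> lji; rewrite metricC H 1?eq_sym.
  by rewrite (val_inj E) eqxx in ij.
rewrite !(tnth_nth 0); apply: h h2 _.
by rewrite lij size_tuple /=.
Qed.

Lemma onb_expansion v : v = \sum_(j < n) g (tnth e j) v *: tnth e j.
Proof.
have [_ hb] := e_onb.
have E : v = \sum_(j < n) coord e j v *: tnth e j.
  rewrite [LHS](coord_span (X := e)) ?(span_basis hb) ?memvf //.
  by apply: eq_bigr => j _; rewrite -tnth_nth.
rewrite [LHS]E; apply: eq_bigr => j _; congr (_ *: _).
rewrite [in RHS]E linear_sumr (bigD1 j) //= big1 => [|i ij].
  by rewrite linearZr_LR /= metric_onb eqxx mulr1 addr0.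
by rewrite linearZr_LR /= metric_onb eq_sym (negbTE ij) mulr0.
Qed.

Lemma multilin_expansion (theta : seq V -> R) s1 v s2 : multilin theta ->
  theta (s1 ++ v :: s2) = \sum_(j < n) g (tnth e j) v * theta (s1 ++ tnth e j :: s2).
Proof.
move=> h.
have h0 : theta (s1 ++ 0 :: s2) = 0.
  have := h s1 s2 1 0 0; rewrite scaler0 add0r mul1r => /eqP.
  by rewrite -subr_eq subrr eq_sym => /eqP.
rewrite {1}[v]onb_expansion.
elim/big_rec2: _ => // j x y _ <-.
exact: h.
Qed.

Lemma dmul_sumr (I : finType) (alpha : dform) (beta : I -> dform) s t :
  dmul alpha (fun s t => \sum_i beta i s t) s t = \sum_i dmul alpha (beta i) s t.
Proof.
under eq_bigr => i _ do rewrite dmul_shuffle.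
rewrite dmul_shuffle -shuffle_sum; congr (shuffle _ s t).
by do 4![apply/funext => ?]; rewrite /qmul mulr_sumr.
Qed.

(* The derivation extending the identity counts the arguments. *)
Lemma dmul_metric_number (alpha : dform) s t : lalt (transp alpha) ->
  \sum_(j < n) dmul (iprodl (tnth e j) G) (iprodr (tnth e j) alpha) s t
  = (size t)%:R * alpha s t.
Proof.
elim: t => [|w t IH] in alpha * => ha.
  rewrite mul0r big1 // => j _; rewrite /dmul big1 // => m _; rewrite big1 // => k _.
  rewrite mask0 /iprodl; by case: (mask m s) => [|? ?]; rewrite !(mulr0, mul0r).
have E1 j : iprodr w (iprodl (tnth e j) G) = fun s t => g (tnth e j) w * @dunit R V s t.
  apply/funext=> s'; apply/funext=> t'; rewrite /iprodr /iprodl /metric_form /dunit.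
  by case: s' t' => [|? ?] [|? ?]; rewrite ?mulr1 ?mulr0.
have E2 j : signr (iprodl (tnth e j) G) = fun s t => -1 * iprodl (tnth e j) G s t.
  apply/funext=> s'; apply/funext=> t'; rewrite /signr /iprodl /metric_form.
  by case: s' t' => [|? ?] [|? [|? ?]]; rewrite ?mulr0.
have E3 j : iprodr w (iprodr (tnth e j) alpha)
    = fun s t => -1 * iprodr (tnth e j) (iprodr w alpha) s t.
  apply/funext=> s'; apply/funext=> t'; rewrite mulN1r.
  exact: (proj2 (ha s') [::] t').
(* When [w] goes to the metric, the sum over [j] is the expansion of [w] in the basis and gives back
   [alpha] with [w] at the head. When [w] goes to [alpha], the two signs cancel and the induction
   hypothesis applies to [iprodr w alpha]. *)
under eq_bigr => j _ do
  rewrite dmul_consr E1 E2 E3 !dmulZl dmulZr dmul1l mulrA mulrNN !mul1r.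
rewrite big_split /= IH; last by move=> s'; apply: (malt_cons w (ha s')).
rewrite -(multilin_expansion [::] w t (proj1 (ha s))) /=.
by rewrite /iprodr /transp; ring.
Qed.

Lemma transp_metric : transp G = G.
Proof.
apply/funext=> s; apply/funext=> t; rewrite /transp /metric_form.
by case: s t => [|? [|? ?]] [|? [|? ?]] //; rewrite metricC.
Qed.

Lemma dalt_metric : dalt G.
Proof.
have h : lalt G.
  move=> t; split=> s1 s2 *; rewrite /metric_form.
    case: s1 s2 t => [|? [|? ?]] [|? ?] [|? [|? ?]] /=; rewrite ?mulr0 ?addr0 //.
    by rewrite linearPl.
  by case: s1 s2 => [|? [|? ?]] [|? ?] /=; rewrite ?oppr0.
by split; rewrite ?transp_metric.
Qed.

Lemma dhom_metric : dhom 1 1 G.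
Proof. by move=> [|? [|? ?]] [|? [|? ?]]. Qed.

(** Of the four ways to insert the two copies of [e_j], both in [G] gives the trace [n], one in each
    factor gives minus the number of right or of left arguments by [dmul_metric_number], and both in
    [alpha] gives the product of [G] with [c alpha]. *)
Lemma contraction_dmul_metric (alpha : dform) s t : dalt alpha ->
  c (dmul G alpha) s t
  = dmul G (c alpha) s t + (n%:R - (size s)%:R - (size t)%:R) * alpha s t.
Proof.
case=> hl hr; rewrite {1}/contraction.
have E1 j : iprodr (tnth e j) (iprodl (tnth e j) G) = @dunit R V.
  apply/funext=> s'; apply/funext=> t'; rewrite /iprodr /iprodl /metric_form /dunit.
  by case: s' t' => [|? ?] [|? ?] //; rewrite metric_onb eqxx.
have E2 j : signr (iprodl (tnth e j) G) = fun s t => -1 * iprodl (tnth e j) G s t.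
  apply/funext=> s'; apply/funext=> t'; rewrite /signr /iprodl /metric_form.
  by case: s' t' => [|? ?] [|? [|? ?]]; rewrite ?mulr0.
have E3 : signl G = fun s t => -1 * G s t.
  apply/funext=> s'; apply/funext=> t'; rewrite /signl /metric_form.
  by case: s' t' => [|? [|? ?]] [|? [|? ?]]; rewrite ?mulr0.
have E4 j : iprodr (tnth e j) (fun s t => -1 * G s t)
    = fun s t => -1 * transp (iprodl (tnth e j) G) s t.
  apply/funext=> s'; apply/funext=> t'; rewrite /iprodr /iprodl /transp.
  by rewrite -[G (_ :: _) _]/(transp G _ _) transp_metric.
have E5 : signr (fun s t => -1 * G s t) = G.
  apply/funext=> s'; apply/funext=> t'; rewrite /signr /metric_form.
  by case: s' t' => [|? [|? ?]] [|? [|? ?]]; rewrite ?mulr0 //=; ring.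
under eq_bigr => j _ do
  rewrite dmul_consl !dmul_consr E1 E2 E3 E4 E5 dmul1l !dmulZl.
rewrite !big_split /= sumr_const card_ord -!mulr_sumr dmul_metric_number //.
rewrite -dmul_sumr.
have -> : \sum_(j < n) dmul (transp (iprodl (tnth e j) G)) (iprodl (tnth e j) alpha) s t
    = (size s)%:R * alpha s t.
  rewrite -[alpha s t]/(transp alpha t s) -(@dmul_metric_number (transp alpha) t s) //.
  by apply: eq_bigr => j _; rewrite -dmul_transp.
by rewrite -[_ *+ n]mulr_natl /contraction /iprodl /iprodr; ring.
Qed.

(** The scalar is the sum of [n - 2 (p - i)] over [i < j], one term for each passage of [c] across
    [G]. The bound on [j] keeps each degree [p - i] free of truncation. *)
Lemma iter_contraction_dmul_metric p (alpha : dform) j :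
  dalt alpha -> dhom p p alpha -> (j <= p.+1)%N ->
  iter j c (dmul G alpha)
  = fun s t => dmul G (iter j c alpha) s t
      + j%:R * (n%:R - 2 * p%:R + j%:R - 1) * iter j.-1 c alpha s t.
Proof.
move=> ha hh; elim: j => [|j IH] hj.
  by apply/funext=> s; apply/funext=> t; rewrite /= !mul0r addr0.
rewrite iterS IH 1?ltnW //; apply/funext=> s; apply/funext=> t.
rewrite {1}/contraction big_split /= -mulr_sumr.
rewrite -/(contraction e (dmul G (iter j c alpha)) s t).
rewrite contraction_dmul_metric; last exact: dalt_iter_contraction.
rewrite -addrA; congr (_ + _).
(* For [j = 0] the predecessor [j.-1] is again 0 and does not match the extra contraction; the
   factor [j%:R] removes this case. *)
have -> : j%:R * (n%:R - 2 * p%:R + j%:R - 1)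
    * (\sum_(i < n) iter j.-1 c alpha (tnth e i :: s) (tnth e i :: t))
    = j%:R * (n%:R - 2 * p%:R + j%:R - 1) * iter j c alpha s t.
  by case: j {IH hj} => [|j] //; rewrite !mul0r.
have [/andP[/eqP-> /eqP->]|hst] := boolP ((size s == p - j)%N && (size t == p - j)%N).
  by rewrite natrB // mulrSr; ring.
by rewrite (dhom_iter_contraction e hh hst) !mulr0 addr0.
Qed.

(* The commutation relation of the sl(2)-triple formed by [G], [c] and their
   commutator, applied [m] times. *)
Lemma iter_contraction_dpow_metric d m (zeta : dform) :
  dalt zeta -> dhom d d zeta -> (d + m <= n)%N ->
  iter (d + m) c (dmul (dpow G m) zeta) [::] [::] * (d`! * (n - d - m)`!)%:R
  = ((d + m)`! * (n - d)`!)%:R * iter d c zeta [::] [::].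
Proof.
move=> hz hh; elim: m => [|m IH] hm.
  by rewrite addn0 subn0 dmul1l mulrC.
have hp : dhom (d + m) (d + m) (dmul (dpow G m) zeta).
  by rewrite addnC -{1 2}[m]mul1n; apply: dhom_dmul => //; apply/dhom_dpow/dhom_metric.
rewrite addnS [dpow G m.+1]/= -/(dpow G m) -dmulA.
rewrite (iter_contraction_dmul_metric _ hp) //; last first.
  by apply: dalt_dmul => //; apply/dalt_dpow/dalt_metric.
(* At the empty lists the term still containing [G] vanishes, and only the scalar multiple
   remains. *)
rewrite dmul_nil mul0r add0r.
have hm' : (d + m <= n)%N by lia.
have {IH} := IH hm'; rewrite [(d + m).+1.-1]/=.
rewrite (_ : n - d - m = (n - d - m.+1).+1)%N; last by lia.
rewrite !factS !natrM => IH.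
(* The scalar is [n - d - m], which is the factor by which [(n - d - m)]! exceeds the next
   factorial. *)
have -> : (n%:R - 2 * (d + m)%:R + (d + m).+1%:R - 1 = (n - d - m.+1).+1%:R :> R).
  rewrite (_ : (n - d - m.+1).+1 = n - (d + m))%N; last by lia.
  by rewrite natrB ?mulrSr; [ring|lia].
transitivity ((d + m).+1%:R * (iter (d + m) c (dmul (dpow G m) zeta) [::] [::]
  * (d`!%:R * ((n - d - m.+1).+1%:R * (n - d - m.+1)`!%:R)))); first by ring.
by rewrite IH; ring.
Qed.

(** Two evaluations of the [n]-fold contraction of a top form are compared: [iter_contraction_top]
    gives [n]! times its value on the basis, and [iter_contraction_dpow_metric] with [m = n - d]
    gives a multiple of the [d]-fold contraction of [zeta]. *)
Lemma dmul_dpow_metric_top d (zeta : dform) :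
  dalt zeta -> dhom d d zeta -> (d <= n)%N ->
  dmul (dpow G (n - d)) zeta e e / (n - d)`!%:R = iter d c zeta [::] [::] / d`!%:R.
Proof.
move=> hz hh hd.
have := iter_contraction_dpow_metric (m := n - d) hz hh.
rewrite subnKC // subnn fact0 muln1 => /(_ (leqnn n)).
rewrite iter_contraction_top; first last.
- rewrite -{1 2}(subnK hd) -{1 2}[(n - d)%N]mul1n.
  by apply: dhom_dmul => //; apply/dhom_dpow/dhom_metric.
- by apply: dalt_dmul => //; apply/dalt_dpow/dalt_metric.
rewrite natrM -!mulrA => /mulfI E.
have {}E := E _; apply/eqP; rewrite eqr_div ?pnatr_eq0 -?lt0n ?fact_gt0 //.
by rewrite E ?pnatr_eq0 -?lt0n ?fact_gt0 // mulrC.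
Qed.

End Metric.

(** * Signs of shuffles and the Hodge star in an orthonormal basis *)

(** The shuffle is sorted by adjacent swaps, one for each inversion. Antisymmetry is asked only at
    the length of [s], because [vol] is a determinant of fixed size [n]. *)
Lemma mask_antisym (R : pzRingType) (T : Type) (F : seq T -> R) (s : seq T) (m : bitseq) :
  (forall s1 s2 u v, (size s1 + size s2).+2 = size s ->
     F (s1 ++ u :: v :: s2) = - F (s1 ++ v :: u :: s2)) ->
  size m = size s ->
  F (mask m s ++ mask (map negb m) s) = (-1) ^+ inversions m * F s.
Proof.
elim: s m F => [|x s IH] [|b m] F // hF; first by rewrite mul1r.
move=> [sz].
have IHx := IH m (fun w => F (x :: w)) _ sz.
have {}IHx : F (x :: mask m s ++ mask [seq ~~ i | i <- m] s)
    = (-1) ^+ inversions m * F (x :: s).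
  by apply: IHx => s1 s2 u v h; rewrite -!cat_cons hF //= -h.
case: b => //=; rewrite mul1n exprD -mulrA -IHx.
have : (size (mask m s) + size (mask (map negb m) s) = size s)%N.
  exact: (@size_mask_split T _ (Tuple (introT eqP sz)) s erefl).
have -> : count id m = size (mask m s) by rewrite size_mask.
move: (mask m s) (mask (map negb m) s) => s1 s2 sz12.
(* An unmarked head [x] sits after [s1]; it is carried back to the front past the entries of [s1],
   starting with the last. *)
elim/last_ind: s1 s2 sz12 => [|s1 y IH1] s2 sz12; first by rewrite mul1r.
rewrite cat_rcons hF ?IH1 /=; first last.
- by rewrite -sz12 size_rcons; lia.
- by rewrite -sz12 size_rcons /=; lia.
by rewrite size_rcons exprS mulN1r mulNr cat_rcons.
Qed.

(** Disjoint masks mark at most [size I] positions in total ([hle]). The cardinality hypothesis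
    forces equality, so every position is marked by exactly one of them. *)
Lemma eq_map_negb (I J : bitseq) : size I = size J ->
  (size I <= count id I + count id J)%N ->
  (forall i, nth false I i -> ~~ nth false J i) -> J = map negb I.
Proof.
have hle (A B : bitseq) : size A = size B ->
    (forall i, nth false A i -> ~~ nth false B i) ->
    (count id A + count id B <= size A)%N.
  elim: A B => [|a A IH] [|b B] //= [sz] h.
  have le : (count id A + count id B <= size A)%N := IH _ sz (fun i => h i.+1).
  have : (a + b <= 1)%N by case: a b h => [] [] // /(_ 0%N isT).
  lia.
elim: I J => [|a I IH] [|b J] //= [sz] hc h.
have le := hle I J sz (fun i => h i.+1).
congr (_ :: _).
  have : (1 <= a + b)%N by lia.
  by case: a b h {hc} => [] [] // /(_ 0%N isT).
apply: IH => // [|i]; last exact: (h i.+1).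
have : (a + b <= 1)%N by case: a b h {hc} => [] [] // /(_ 0%N isT).
lia.
Qed.

Section Hodge.
Variables (R : realType) (V : vectType R) (g : {dot V for idfun}).
Variables (n : nat) (e : n.-tuple V) (e_onb : orthonormal_basis g e).
Local Notation dform := (dform V).

Lemma vol_swap s1 s2 u v : (size s1 + size s2).+2 = n ->
  vol e g (s1 ++ u :: v :: s2) = - vol e g (s1 ++ v :: u :: s2).
Proof.
move=> sz.
have h1 : (size s1 < n)%N by lia.
have h2 : ((size s1).+1 < n)%N by lia.
pose i := Ordinal h1; pose j := Ordinal h2.
have ij : i != j by rewrite -val_eqE /= neq_ltn leqnn.
rewrite /vol; set B := (X in - \det X).
have -> : \matrix_(a < n, b < n) g (s1 ++ u :: v :: s2)`_a (tnth e b) = xrow i j B.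
  apply/matrixP=> a b; rewrite !mxE; congr (g _ _).
  case: tpermP => [->|->|/eqP ai /eqP aj].
  - by rewrite !nth_cat /= ltnn subnn ltnNge leqnSn subSnn.
  - by rewrite !nth_cat /= ltnn subnn ltnNge leqnSn subSnn.
  rewrite !nth_cat; case: ltnP => // ha.
  have {}ai : nat_of_ord a <> size s1 by move=> E; apply/(negP ai)/eqP/val_inj.
  have {}aj : nat_of_ord a <> (size s1).+1 by move=> E; apply/(negP aj)/eqP/val_inj.
  have {}ha : (size s1 <= nat_of_ord a)%N := ha.
  have : (1 < a - size s1)%N by lia.
  by case: (a - size s1)%N => [|[|k]].
by rewrite /xrow row_permE det_mulmx det_perm odd_tperm ij mulN1r.
Qed.

Lemma vol_onb : vol e g e = 1.
Proof.
rewrite /vol -[RHS](det1 R n); congr (\det _); apply/matrixP=> i j; rewrite !mxE.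
by rewrite -tnth_nth metric_onb.
Qed.

Lemma vol_not_uniq s : size s = n -> ~~ uniq s -> vol e g s = 0.
Proof.
move=> sz /(uniqPn 0)[i [j [ij js E]]]; rewrite sz in js.
have ni := ltn_trans ij js.
apply: (@determinant_alternate _ _ _ (Ordinal ni) (Ordinal js)).
  by rewrite -val_eqE /= neq_ltn ij.
by move=> k; rewrite !mxE /= E.
Qed.

Lemma vol_mask (I : n.-tuple bool) :
  vol e g (mask I e ++ mask (map negb I) e) = (-1) ^+ inversions I.
Proof.
rewrite (@mask_antisym R V (vol e g)) ?size_tuple //; first by rewrite vol_onb mulr1.
by move=> s1 s2 u v; rewrite ?size_tuple; apply: vol_swap.
Qed.

(** A mask of complementary cardinality other than the complement of [I] meets [I]; the volume form
    then has a repeated argument and vanishes. *)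
Lemma hodge_mask (theta : seq V -> R) (I : n.-tuple bool) :
  hodge e g theta (mask I e) = (-1) ^+ inversions I * theta (mask (map negb I) e).
Proof.
have szI : size (mask I e) = count id I by rewrite size_mask ?size_tuple.
rewrite /hodge (eq_bigl (fun J : n.-tuple bool => (count id J + count id I == n)%N));
  last by move=> J; rewrite szI.
rewrite (bigD1 [tuple of map negb I]) /=; last first.
  by rewrite count_negb size_tuple subnK // -{2}(size_tuple I) count_size.
rewrite vol_mask big1 ?addr0 // => J /andP[/eqP hc hJ].
rewrite vol_not_uniq ?mul0r //.
  by rewrite size_cat szI (@size_mask _ J) ?size_tuple // addnC.
apply: contra hJ; rewrite cat_uniq => /and3P[_ /hasPn h _].
apply/eqP/val_inj/eq_map_negb; rewrite ?size_tuple //.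
  by rewrite addnC hc.
move=> i hi; apply/negP => hj.
have ni : (i < n)%N.
  by rewrite ltnNge; apply: contraTN hi => hi; rewrite nth_default ?size_tuple.
have ue : uniq e by exact: uniq_onb e_onb.
have memE (K : n.-tuple bool) : (nth 0 e i \in mask K e) = nth false K i.
  by rewrite in_mask // index_uniq ?size_tuple // mem_nth ?size_tuple.
have := h (nth 0 e i); rewrite /= !memE => /(_ hj).
by rewrite hi.
Qed.

(** The signs of the two Hodge stars are exactly the shuffle signs of the masks [I] and [J] in the
    product. *)
Lemma dinner_double_hodge (X eta : dform) :
  dinner e (double_hodge e g X) eta = dmul eta X e e.
Proof.
pose F I J := (-1) ^+ inversions I * (-1) ^+ inversions J
     * eta (mask I e) (mask J e) * X (mask (map negb I) e) (mask (map negb J) e).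
rewrite /dmul -/(F _ _).
under [RHS]eq_bigr => I _ do
  rewrite -(big_tuple_cast_bool (F I) (esym (size_tuple e))).
rewrite -(big_tuple_cast_bool (fun I => \sum_(J : n.-tuple bool) F I J) (esym (size_tuple e))).
apply: eq_bigr => I _; apply: eq_bigr => J _.
by rewrite /double_hodge !hodge_mask /F; ring.
Qed.

End Hodge.

(** * The binomial formula for additive operators that commute on a stable subset *)

Section CommutingOperators.
Variables (U : zmodType) (P : U -> Prop) (X Y : U -> U).
Hypotheses (XD : {morph X : x y / x + y}) (YD : {morph Y : x y / x + y}).
Hypotheses (PX : forall u, P u -> P (X u)) (PY : forall u, P u -> P (Y u)).
Hypothesis XY : forall u, P u -> X (Y u) = Y (X u).

Lemma iter_closed n u : P u -> P (iter n X u).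
Proof. by move=> Pu; elim: n => //= n; apply: PX. Qed.

Lemma iter_morphD n : {morph iter n X : x y / x + y}.
Proof. by move=> x y; elim: n => //= n ->. Qed.

Lemma morph_sumMn (I : finType) (F : I -> U) (k : I -> nat) :
  X (\sum_i F i *+ k i) = \sum_i X (F i) *+ k i.
Proof.
have X0 : X 0 = 0 by apply: (addrI (X 0)); rewrite -XD !addr0.
rewrite (big_morph X XD X0); apply: eq_bigr => i _.
by elim: (k i) => [|m IH]; rewrite ?mulr0n // !mulrS XD IH.
Qed.

Lemma commute_iterl n u : P u -> iter n X (Y u) = Y (iter n X u).
Proof.
by move=> Pu; elim: n => //= n ->; rewrite XY //; apply: iter_closed.
Qed.

End CommutingOperators.

Lemma commute_iter (U : zmodType) (P : U -> Prop) (X Y : U -> U)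
  (PX : forall u, P u -> P (X u)) (PY : forall u, P u -> P (Y u))
  (XY : forall u, P u -> X (Y u) = Y (X u)) a b u :
  P u -> iter a X (iter b Y u) = iter b Y (iter a X u).
Proof.
move=> Pu; elim: b => //= b <-.
by apply: (commute_iterl (P := P)) => //; apply: iter_closed.
Qed.

(** Pascal's rule, as in a commutative ring. Commutation is required only on [P], since the
    contraction operators below commute only on antisymmetric functions. *)
Lemma iter_addC (U : zmodType) (P : U -> Prop) (X Y : U -> U)
  (XD : {morph X : x y / x + y}) (YD : {morph Y : x y / x + y})
  (PX : forall u, P u -> P (X u)) (PY : forall u, P u -> P (Y u))
  (XY : forall u, P u -> X (Y u) = Y (X u)) n u :
  P u ->
  iter n (fun u => X u + Y u) u
  = \sum_(i < n.+1) iter i X (iter (n - i) Y u) *+ 'C(n, i).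
Proof.
move=> Pu; elim: n => [|n IH]; first by rewrite big_ord1.
rewrite iterS IH (morph_sumMn XD) (morph_sumMn YD).
rewrite [RHS]big_ord_recl bin0 /=.
under [in RHS]eq_bigr => i _ do rewrite /bump /= add1n binS mulrnDr subSS.
rewrite big_split /= addrA [RHS]addrC; congr (_ + _).
transitivity (\sum_(i < n.+2) iter i X (iter (n.+1 - i) Y u) *+ 'C(n, i)).
  rewrite [RHS]big_ord_recr /= bin_small // mulr0n addr0; apply: eq_bigr => i _.
  rewrite -(commute_iterl PX XY); last exact: iter_closed.
  by rewrite -iterS subSn // -ltnS.
by rewrite big_ord_recl /= bin0.
Qed.

(** * The four parts of the contraction of a product, and the expansion of its powers *)

Section FactorOperators.
Variables (R : realType) (V : vectType R) (n : nat) (e : n.-tuple V).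
Local Notation dform := (dform V).
Local Notation c := (contraction e).
Local Notation W := (seq V -> seq V -> seq V -> seq V -> R).

(* In [conab] the left [e_j] goes to the factor number [a] and the right one to
   the factor number [b]; the signs are those of the shuffles. *)
Definition con11 (Phi : W) : W := fun s t s' t' =>
  \sum_(j < n) Phi (tnth e j :: s) (tnth e j :: t) s' t'.
Definition con12 (Phi : W) : W := fun s t s' t' =>
  \sum_(j < n) (-1) ^+ size t * Phi (tnth e j :: s) t s' (tnth e j :: t').
Definition con21 (Phi : W) : W := fun s t s' t' =>
  \sum_(j < n) (-1) ^+ size s * Phi s (tnth e j :: t) (tnth e j :: s') t'.
Definition con22 (Phi : W) : W := fun s t s' t' =>
  \sum_(j < n) (-1) ^+ (size s + size t) * Phi s t (tnth e j :: s') (tnth e j :: t').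

(** Grouping by the factor that receives the left vector allows two nested binomial expansions in
    place of one multinomial formula. *)
Definition con1 (Phi : W) : W := con12 Phi + con11 Phi.
Definition con2 (Phi : W) : W := con21 Phi + con22 Phi.

Lemma contraction_shuffle Phi :
  c (shuffle Phi) = shuffle (con1 Phi + con2 Phi).
Proof.
apply/funext => s; apply/funext => t; rewrite /contraction.
under eq_bigr => j _ do rewrite shuffle_consl shuffle_consr.
rewrite -shuffle_sum; congr (shuffle _ s t).
do 4![apply/funext => ?]; rewrite /con1 /con2 !addrfctE /con11 /con12 /con21 /con22.
rewrite -!big_split; apply: eq_bigr => j _ /=; rewrite exprD; ring.
Qed.

Definition qantisym (Phi : W) : Prop :=
  [/\ forall t s' t', antisym (fun s => Phi s t s' t'),
      forall s s' t', antisym (fun t => Phi s t s' t'),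
      forall s t t', antisym (fun s' => Phi s t s' t')
    & forall s t s', antisym (fun t' => Phi s t s' t')].

Lemma qantisym_con11 Phi : qantisym Phi -> qantisym (con11 Phi).
Proof.
case=> h1 h2 h3 h4; split=> x y z s1 s2 u v; rewrite /con11 -sumrN;
  apply: eq_bigr => j _; rewrite -?cat_cons;
  by [apply: h1|apply: h2|apply: h3|apply: h4].
Qed.

Lemma qantisym_con12 Phi : qantisym Phi -> qantisym (con12 Phi).
Proof.
case=> h1 h2 h3 h4; split=> x y z s1 s2 u v; rewrite /con12 -sumrN;
  apply: eq_bigr => j _; rewrite -mulrN ?size_cat -?cat_cons; congr (_ * _);
  by [apply: h1|apply: h2|apply: h3|apply: h4].
Qed.

Lemma qantisym_con21 Phi : qantisym Phi -> qantisym (con21 Phi).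
Proof.
case=> h1 h2 h3 h4; split=> x y z s1 s2 u v; rewrite /con21 -sumrN;
  apply: eq_bigr => j _; rewrite -mulrN ?size_cat -?cat_cons; congr (_ * _);
  by [apply: h1|apply: h2|apply: h3|apply: h4].
Qed.

Lemma qantisym_con22 Phi : qantisym Phi -> qantisym (con22 Phi).
Proof.
case=> h1 h2 h3 h4; split=> x y z s1 s2 u v; rewrite /con22 -sumrN;
  apply: eq_bigr => j _; rewrite -mulrN ?size_cat -?cat_cons; congr (_ * _);
  by [apply: h1|apply: h2|apply: h3|apply: h4].
Qed.

Lemma qantisymD Phi Psi : qantisym Phi -> qantisym Psi -> qantisym (Phi + Psi).
Proof.
case=> h1 h2 h3 h4 [k1 k2 k3 k4]; split=> x y z s1 s2 u v;
  rewrite !addrfctE opprD; congr (_ + _);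
  by [apply: h1|apply: h2|apply: h3|apply: h4|apply: k1|apply: k2|apply: k3|apply: k4].
Qed.

Lemma con11D : {morph con11 : Phi Psi / Phi + Psi}.
Proof.
move=> Phi Psi; do 4![apply/funext => ?]; rewrite !addrfctE /con11 -big_split.
by [].
Qed.

Lemma con12D : {morph con12 : Phi Psi / Phi + Psi}.
Proof.
move=> Phi Psi; do 4![apply/funext => ?]; rewrite !addrfctE /con12 -big_split.
by apply: eq_bigr => j _; rewrite /= mulrDr.
Qed.

Lemma con21D : {morph con21 : Phi Psi / Phi + Psi}.
Proof.
move=> Phi Psi; do 4![apply/funext => ?]; rewrite !addrfctE /con21 -big_split.
by apply: eq_bigr => j _; rewrite /= mulrDr.
Qed.

Lemma con22D : {morph con22 : Phi Psi / Phi + Psi}.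
Proof.
move=> Phi Psi; do 4![apply/funext => ?]; rewrite !addrfctE /con22 -big_split.
by apply: eq_bigr => j _; rewrite /= mulrDr.
Qed.

(** Both operators insert into the left list of the first factor, in opposite orders. The
    antisymmetry sign is cancelled by [(-1) ^+ size t], whose exponent grows by one under [con11].
    The other pairs sharing a list behave in the same way. *)
Lemma con12_con11 Phi : qantisym Phi -> con12 (con11 Phi) = con11 (con12 Phi).
Proof.
case=> h1 _ _ _; apply/funext => s; apply/funext => t; apply/funext => s'; apply/funext => t'.
rewrite /con11 /con12; under eq_bigr => j _ do rewrite mulr_sumr.
rewrite exchange_big; apply: eq_bigr => i _; apply: eq_bigr => j _ /=.
by rewrite (h1 _ _ _ [::]) /= exprS; ring.
Qed.

Lemma con21_con22 Phi : qantisym Phi -> con21 (con22 Phi) = con22 (con21 Phi).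
Proof.
case=> _ _ h3 _; apply/funext => s; apply/funext => t; apply/funext => s'; apply/funext => t'.
rewrite /con21 /con22; under eq_bigr => j _ do rewrite mulr_sumr.
under [RHS]eq_bigr => j _ do rewrite mulr_sumr.
rewrite exchange_big; apply: eq_bigr => i _; apply: eq_bigr => j _ /=.
by rewrite (h3 _ _ _ [::]) /= !(exprS, exprD); ring.
Qed.

Lemma con11_con21 Phi : qantisym Phi -> con11 (con21 Phi) = con21 (con11 Phi).
Proof.
case=> _ h2 _ _; apply/funext => s; apply/funext => t; apply/funext => s'; apply/funext => t'.
rewrite /con21 /con11; under [RHS]eq_bigr => j _ do rewrite mulr_sumr.
rewrite exchange_big; apply: eq_bigr => i _; apply: eq_bigr => j _ /=.
by rewrite (h2 _ _ _ [::]) /= exprS; ring.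
Qed.

(** No list is shared, and [con11] changes the exponent of the sign of [con22] by two. *)
Lemma con11_con22 Phi : con11 (con22 Phi) = con22 (con11 Phi).
Proof.
apply/funext => s; apply/funext => t; apply/funext => s'; apply/funext => t'.
rewrite /con22 /con11; under [RHS]eq_bigr => j _ do rewrite mulr_sumr.
rewrite exchange_big; apply: eq_bigr => i _; apply: eq_bigr => j _ /=.
by rewrite !(exprS, exprD); ring.
Qed.

(** No list is shared; each operator flips the sign of the other, so both orders carry the same
    total sign. *)
Lemma con12_con21 Phi : con12 (con21 Phi) = con21 (con12 Phi).
Proof.
apply/funext => s; apply/funext => t; apply/funext => s'; apply/funext => t'.
rewrite /con12 /con21; under eq_bigr => j _ do rewrite mulr_sumr.
under [RHS]eq_bigr => j _ do rewrite mulr_sumr.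
rewrite exchange_big; apply: eq_bigr => i _; apply: eq_bigr => j _ /=.
by rewrite !exprS; ring.
Qed.

Lemma con12_con22 Phi : qantisym Phi -> con12 (con22 Phi) = con22 (con12 Phi).
Proof.
case=> _ _ _ h4; apply/funext => s; apply/funext => t; apply/funext => s'; apply/funext => t'.
rewrite /con12 /con22; under eq_bigr => j _ do rewrite mulr_sumr.
under [RHS]eq_bigr => j _ do rewrite mulr_sumr.
rewrite exchange_big; apply: eq_bigr => i _; apply: eq_bigr => j _ /=.
by rewrite (h4 _ _ _ [::]) /= !(exprS, exprD); ring.
Qed.

Lemma qantisym_con1 Phi : qantisym Phi -> qantisym (con1 Phi).
Proof. by move=> h; apply: qantisymD; [apply: qantisym_con12|apply: qantisym_con11]. Qed.

Lemma qantisym_con2 Phi : qantisym Phi -> qantisym (con2 Phi).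
Proof. by move=> h; apply: qantisymD; [apply: qantisym_con21|apply: qantisym_con22]. Qed.

Lemma con1D : {morph con1 : Phi Psi / Phi + Psi}.
Proof. by move=> Phi Psi; rewrite /con1 con11D con12D addrACA. Qed.

Lemma con2D : {morph con2 : Phi Psi / Phi + Psi}.
Proof. by move=> Phi Psi; rewrite /con2 con21D con22D addrACA. Qed.

Lemma con1_con2 Phi : qantisym Phi -> con1 (con2 Phi) = con2 (con1 Phi).
Proof.
move=> h; rewrite /con1 /con2 con11D con12D con21D con22D con12_con21 con12_con22 //.
by rewrite con11_con21 // con11_con22 addrACA.
Qed.

(** Here [i] counts the vectors already inserted into the left list of the first factor, whose full
    length is [d]. At the empty lists a nonzero value forces [i = d]. The predicate [deg2] does the
    same for the right list. *)
Definition deg1 (i d : nat) (Phi : W) :=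
  forall s t s' t', (size s + i)%N != d -> Phi s t s' t' = 0.
Definition deg2 (i d : nat) (Phi : W) :=
  forall s t s' t', (size t + i)%N != d -> Phi s t s' t' = 0.

Lemma deg1_con1 i d Phi : deg1 i d Phi -> deg1 i.+1 d (con1 Phi).
Proof.
move=> h s t s' t' hd; rewrite /con1 !addrfctE /con11 /con12 !big1 ?addr0 // => j _;
  by rewrite h ?mulr0 //= addSnnS.
Qed.

Lemma deg1_con2 i d Phi : deg1 i d Phi -> deg1 i d (con2 Phi).
Proof.
move=> h s t s' t' hd; rewrite /con2 !addrfctE /con21 /con22 !big1 ?addr0 // => j _;
  by rewrite h ?mulr0.
Qed.

Lemma deg2_con11 i d Phi : deg2 i d Phi -> deg2 i.+1 d (con11 Phi).
Proof.
by move=> h s t s' t' hd; apply: big1 => j _; rewrite h ?mulr0 //= addSnnS.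
Qed.

Lemma deg2_con21 i d Phi : deg2 i d Phi -> deg2 i.+1 d (con21 Phi).
Proof.
by move=> h s t s' t' hd; apply: big1 => j _; rewrite h ?mulr0 //= addSnnS.
Qed.

Lemma deg2_con12 i d Phi : deg2 i d Phi -> deg2 i d (con12 Phi).
Proof. by move=> h s t s' t' hd; apply: big1 => j _; rewrite h ?mulr0. Qed.

Lemma deg2_con22 i d Phi : deg2 i d Phi -> deg2 i d (con22 Phi).
Proof. by move=> h s t s' t' hd; apply: big1 => j _; rewrite h ?mulr0. Qed.

Lemma iter_raise (D : nat -> W -> Prop) (X : W -> W) r i Phi :
  (forall i Phi, D i Phi -> D i.+1 (X Phi)) -> D i Phi -> D (r + i)%N (iter r X Phi).
Proof. by move=> h h0; elim: r => //= r; apply: h. Qed.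

Lemma qsum_nil (I : finType) (F : I -> W) (k : I -> nat) :
  (\sum_i F i *+ k i) [::] [::] [::] [::] = \sum_i F i [::] [::] [::] [::] *+ k i.
Proof.
rewrite !fct_sumE; apply: eq_bigr => i _.
by elim: (k i) => // m IH; rewrite !mulrS -IH.
Qed.

Lemma iter_contraction_shuffle r Phi :
  iter r c (shuffle Phi) = shuffle (iter r (fun Phi => con1 Phi + con2 Phi) Phi).
Proof. by elim: r => //= r ->; rewrite contraction_shuffle. Qed.

(* All other terms of the binomial expansions vanish for reasons of degree. *)
Lemma iter_contraction_shuffle_nil k Phi :
  qantisym Phi -> deg1 0 k Phi -> deg2 0 k Phi ->
  iter (2 * k) c (shuffle Phi) [::] [::]
  = (\sum_(j < k.+1) iter j con12 (iter j con21
       (iter (k - j) con11 (iter (k - j) con22 Phi))) [::] [::] [::] [::]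
       *+ ('C(k, j) ^ 2)) *+ 'C(2 * k, k).
Proof.
move=> ha h1 h2.
rewrite iter_contraction_shuffle shuffle_nil.
rewrite (iter_addC con1D con2D qantisym_con1 qantisym_con2 con1_con2) // qsum_nil.
have hk : (k < (2 * k).+1)%N by lia.
(* Each [con1] adds one left vector to the first factor and [con2] adds none, so exactly [k] of the
   [2 * k] operators are [con1]. *)
rewrite (bigD1 (Ordinal hk)) //= big1 => [|i hi]; last first.
  have d1 : deg1 (i + 0) k (iter i con1 (iter (2 * k - i) con2 Phi)).
    apply: (iter_raise (D := fun i => deg1 i k)) => [j Psi|]; first exact: deg1_con1.
    by elim: (_ - _)%N => //= m; apply: deg1_con2.
  rewrite d1 ?mul0rn // add0n addn0; apply: contra hi => /eqP hi.
  exact/eqP/val_inj.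
rewrite addr0 (_ : 2 * k - k = k)%N; last by lia.
congr (_ *+ _).
rewrite (iter_addC con21D con22D qantisym_con21 qantisym_con22 con21_con22) //.
rewrite (morph_sumMn (iter_morphD con1D _)) qsum_nil; apply: eq_bigr => j _.
set Psi := iter j con21 (iter (k - j) con22 Phi).
have aPsi : qantisym Psi.
  exact: (iter_closed qantisym_con21 j (iter_closed qantisym_con22 (k - j) ha)).
have dPsi : deg2 (j + 0) k Psi.
  apply: (iter_raise (D := fun i => deg2 i k)) => [i Xi|]; first exact: deg2_con21.
  by elim: (_ - _)%N => //= m; apply: deg2_con22.
rewrite (iter_addC con12D con11D qantisym_con12 qantisym_con11 con12_con11) //.
(* The right list of the first factor receives [j] vectors from [con21] and [k - i] from [con11]; a
   total of [k] forces [i = j]. *)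
rewrite qsum_nil (bigD1 j) //= big1 => [|i hi]; last first.
  have d2 : deg2 (k - i + (j + 0)) k (iter i con12 (iter (k - i) con11 Psi)).
    elim: (i : nat) (k - i)%N => [|m IH] r /=; last by apply: deg2_con12.
    by apply: (iter_raise (D := fun i => deg2 i k)) => // l Xi; apply: deg2_con11.
  rewrite d2 ?mul0rn //=; apply: contra hi => /eqP hi.
  by apply/eqP/val_inj => /=; have := ltn_ord i; lia.
rewrite addr0 -mulrnA; congr (_ *+ _).
rewrite /Psi (commute_iter qantisym_con11 qantisym_con21 con11_con21) //.
exact: (iter_closed qantisym_con22 (k - j) ha).
Qed.

(** * Evaluation of the surviving terms on a product of two double forms *)

Lemma qantisym_qmul (alpha beta : dform) :
  dalt alpha -> dalt beta -> qantisym (qmul alpha beta).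
Proof.
case=> a1 a2 [b1 b2]; split=> x y z s1 s2 u v; rewrite /qmul.
- by rewrite (proj2 (a1 _)) mulNr.
- by rewrite (proj2 (a2 x) s1 s2 u v : alpha x _ = _) mulNr.
- by rewrite (proj2 (b1 _)) mulrN.
- by rewrite (proj2 (b2 z) s1 s2 u v : beta z _ = _) mulrN.
Qed.

Lemma iter_con11_qmul r (alpha beta : dform) :
  iter r con11 (qmul alpha beta) = qmul (iter r c alpha) beta.
Proof.
elim: r => //= r ->; do 4![apply/funext => ?].
by rewrite /con11 /qmul /contraction mulr_suml.
Qed.

(** The sign is trivial wherever [alpha] is nonzero, its two lists having the same length [k]. *)
Lemma iter_con22_qmul k r (alpha beta : dform) : dhom k k alpha ->
  iter r con22 (qmul alpha beta) = qmul alpha (iter r c beta).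
Proof.
move=> h; elim: r => //= r ->; apply/funext => s; apply/funext => t.
apply/funext => s'; apply/funext => t'.
rewrite /con22 /qmul /contraction mulr_sumr; apply: eq_bigr => j _.
have [/andP[/eqP -> /eqP ->]|/h->] := boolP ((size s == k) && (size t == k)).
  by rewrite addnn -mul2n exprM sqrrN !expr1n mul1r.
by rewrite !mul0r mulr0.
Qed.

Lemma iter_con21_diag r Phi s w t' :
  iter r con21 Phi s w w t'
  = (-1) ^+ (size s * r) * iter r (cons_sum e) (fun w => Phi s w w t') w.
Proof.
elim: r w => [|r IH] w; first by rewrite muln0 mul1r.
rewrite /= /con21 /cons_sum big_tuple mulr_sumr; apply: eq_bigr => j _.
by rewrite IH mulnS exprD mulrA.
Qed.

Lemma iter_con12_diag r Phi w :
  iter r con12 Phi w [::] [::] w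
  = iter r (cons_sum e) (fun w => Phi w [::] [::] w) w.
Proof.
elim: r w => //= r IH w.
rewrite /con12 /cons_sum big_tuple; apply: eq_bigr => j _.
by rewrite mul1r IH.
Qed.

(** The [con21] sum over the masks [J] and the [con12] sum over the masks [I] each contribute [b]!.
    Right arguments of [gamma] are paired with left arguments of [delta] and conversely, whence the
    transpose. *)
Lemma iter_con12_con21_qmul b (gamma delta : dform) :
  dalt gamma -> dalt delta -> dhom b b gamma ->
  iter b con12 (iter b con21 (qmul gamma delta)) [::] [::] [::] [::]
  = (-1) ^+ b * b`!%:R ^+ 2 * dinner e gamma (transp delta).
Proof.
move=> [g1 g2] [d1 d2] hg.
pose H I w := (-1) ^+ (size w * b) * (gamma w (mask I e) * delta (mask I e) w) *+ b`!.
rewrite iter_con12_diag.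
have -> : (fun w => iter b con21 (qmul gamma delta) w [::] [::] w)
    = fun w => \sum_(J : (size e).-tuple bool) H J w.
  apply/funext => w; rewrite iter_con21_diag iter_cons_sum_mask.
  - by rewrite mulrnAr mulr_sumr -sumrMnl.
  - rewrite /qmul; split=> [s1 s2 u v|s1 s2 u].
      by rewrite (proj2 (d1 _)) -[gamma _ _]/(transp gamma _ _) (proj2 (g2 _)) mulrNN.
    have /eqP := proj2 (g2 w) s1 s2 u u.
    by rewrite -addr_eq0 -mulr2n mulrn_eq0 /= /transp => /eqP ->; rewrite mul0r.
  - by move=> s /negbTE hs; rewrite /qmul hg ?hs ?andbF ?mul0r.
rewrite iter_cons_sum_mask; first last.
- move=> s /negbTE hs; apply: big1 => J _.
  by rewrite /H hg ?hs // mul0r mulr0 mul0rn.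
- split=> [s1 s2 u v|s1 s2 u].
    apply: eq_bigr => J _; rewrite /H !size_cat /=.
    by rewrite (proj2 (g1 _)) -[delta _ _]/(transp delta _ _) (proj2 (d2 _)) mulrNN.
  apply: big1 => J _.
  have /eqP := proj2 (g1 (mask J e)) s1 s2 u u.
  by rewrite -addr_eq0 -mulr2n mulrn_eq0 /= /H => /eqP ->; rewrite mul0r mulr0 mul0rn.
pose F I := \sum_(J : (size e).-tuple bool) H J (mask I e).
rewrite (big_tuple_cast_bool F (size_tuple e)) /F.
rewrite /dinner mulr_sumr -sumrMnl; apply: eq_bigr => I _.
rewrite (big_tuple_cast_bool (fun J => H J (mask I e)) (size_tuple e)).
rewrite mulr_sumr -sumrMnl; apply: eq_bigr => J _.
rewrite /H /transp.
have [hI|hI] := eqVneq (size (mask I e)) b; last first.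
  by rewrite hg ?(negbTE hI) // !(mul0r, mulr0, mul0rn).
(* The accumulated sign has exponent [b * b], of the same parity as [b]. *)
by rewrite hI -signr_odd oddM andbb signr_odd -mulrnA -[LHS]mulr_natr natrM; ring.
Qed.

(** The coefficient of the [j]-th surviving term is [C(2k,k) C(k,j)^2 j!^2 / (2k)! = 1 / (k-j)!^2],
    with sign [(-1)^j]. Setting [r = k - j] turns it into the stated one. *)
Lemma iter_contraction_dmul_square k (eta : dform) :
  dalt eta -> dhom k k eta -> symmetric_dform eta ->
  iter (2 * k) c (dmul eta eta) [::] [::] / (2 * k)`!%:R
  = \sum_(0 <= r < k.+1) (-1) ^+ (r + k) / r`!%:R ^+ 2
      * dinner e (iter r c eta) (iter r c eta).
Proof.
move=> ha hh hs.
rewrite dmul_shuffle iter_contraction_shuffle_nil; first last.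
- by move=> s t s' t'; rewrite addn0 /qmul => /negbTE ht; rewrite hh ?ht ?andbF ?mul0r.
- by move=> s t s' t'; rewrite addn0 /qmul => /negbTE ht; rewrite hh ?ht ?mul0r.
- exact: qantisym_qmul.
(* The sum is reversed because [j] counts the mixed contractions, whereas [r = k - j] counts those
   within each factor. *)
rewrite big_nat_rev add0n big_mkord -[_ *+ _]mulr_natr mulr_suml mulr_suml.
apply: eq_bigr => j _; rewrite subSS.
have hj : (j <= k)%N by rewrite -ltnS.
rewrite (iter_con22_qmul _ _ hh) iter_con11_qmul.
rewrite iter_con12_con21_qmul; first last.
- by rewrite -{1 2}(subKn hj); apply: dhom_iter_contraction.
- exact: dalt_iter_contraction.
- exact: dalt_iter_contraction.
have -> : transp (iter (k - j) c eta) = iter (k - j) c eta.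
  elim: (k - j)%N => [|r IH]; apply/funext=> s; apply/funext=> t; first exact: hs.
  apply: eq_bigr => i _.
  exact: (congr1 (fun f : dform => f (tnth e i :: s) (tnth e i :: t)) IH).
set D := dinner e _ _.
have f0 m : m`!%:R != 0 :> R by rewrite pnatr_eq0 -lt0n fact_gt0.
have E1 := bin_fact (leq_trans (leqnn k) (leq_pmull k (isT : 0 < 2)%N)).
have E2 := bin_fact hj.
rewrite (_ : 2 * k - k = k)%N in E1; last by lia.
rewrite -E1 -E2.
have -> : (-1) ^+ (k - j + k) = (-1) ^+ j :> R.
  by rewrite -signr_odd -[in RHS]signr_odd oddD oddB // addbAC addbb.
rewrite -mulr_natr !natrM.
have b0 : 'C(2 * k, k)%:R != 0 :> R by rewrite pnatr_eq0 -lt0n bin_gt0; lia.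
have c0 : 'C(k, j)%:R != 0 :> R by rewrite pnatr_eq0 -lt0n bin_gt0.
have j0 := f0 j; have kj0 := f0 (k - j)%N.
field.
by rewrite ?b0 ?c0 ?j0 ?kj0.
Qed.

End FactorOperators.

(** * Both equalities, through the full contraction of the square of [omega^q] *)

Theorem theorem4p1 (R : realType) (V : vectType R) (g : {dot V for idfun})
    (n : nat) (dimV : \dim {:V} = n)
    (e : n.-tuple V) (e_onb : orthonormal_basis g e)
    (p q : nat) (p_ge1 : (1 <= p)%N) (q_gt0 : (0 < q)%N)
    (n_ge2pq : (2 * p * q <= n)%N)
    (omega : dform V) (omega_pp : double_form p p omega)
    (omega_sym : symmetric_dform omega)
    (omega_bianchi : first_bianchi p omega) :
  let c := contraction e in
  dscalar (iter (2 * p * q) c (dpow omega (2 * q))) / (2 * p * q)`!%:R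
    = dinner e (h_form e g p q omega) (dpow omega q)
  /\
  dinner e (h_form e g p q omega) (dpow omega q)
    = \sum_(0 <= r < (p * q).+1)
        (-1) ^+ (r + p * q) / (r`!%:R) ^+ 2
        * dinner e (iter r c (dpow omega q)) (iter r c (dpow omega q)).
Proof.
move=> c; set eta := dpow omega q.
have alt : dalt eta := dalt_dpow q (dalt_double_form omega_pp).
have hom : dhom (p * q) (p * q) eta := dhom_dpow (dhom_double_form omega_pp).
have sym : symmetric_dform eta := dpow_sym q omega_sym.
have E : dinner e (h_form e g p q omega) eta
    = iter (2 * p * q) c (dmul eta eta) [::] [::] / (2 * p * q)`!%:R.
  rewrite dinner_double_hodge // -/eta.
  rewrite -[dscale _ _]/(fun s t => _ * dmul _ eta s t) dmulZr.
  (* The metric power is moved in front of the square of [eta], which has degree [2 * p * q], so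
     that [dmul_dpow_metric_top] applies to that square. *)
  rewrite dmulA (dmulC (q := n - 2 * p * q) hom); last first.
    by rewrite -{1 2}[(n - _)%N]mul1n; apply/dhom_dpow/dhom_metric.
  rewrite -dmulA mulrC (dmul_dpow_metric_top e_onb) //; first exact: dalt_dmul.
  rewrite (_ : 2 * p * q = p * q + p * q)%N; first exact: (dhom_dmul hom hom).
  by rewrite -mulnA mul2n addnn.
rewrite E; split; first by rewrite /dscalar [(2 * q)%N]mul2n -addnn dpowD.
by rewrite -mulnA; apply: iter_contraction_dmul_square.
Qed.
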